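(* Let $p\le n$ be positive integers. The map $\mathcal{R}^{\mathrm{cay}}$ from (a subset of) $\mathrm{T}\,\mathrm{Sp}(2p,2n)$ to $\mathrm{Sp}(2p,2n)$ defined, for $X\in\mathrm{Sp}(2p,2n)$ and $Z\in\mathrm{T}_X\mathrm{Sp}(2p,2n)$ such that $I_{2n}-\frac12S_{X,Z}J_{2n}$ is invertible, by $$\mathcal{R}^{\mathrm{cay}}_X(Z)=\left(I_{2n}-\tfrac12S_{X,Z}J_{2n}\right)^{-1}\left(I_{2n}+\tfrac12S_{X,Z}J_{2n}\right)X,$$ where $S_{X,Z}=G_XZ(XJ_{2p})^\top+XJ_{2p}(G_XZ)^\top$ and $G_X=I_{2n}-\frac12XJ_{2p}X^\top J_{2n}^\top$, is a retraction on $\mathrm{Sp}(2p,2n)$.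
   Context: For a positive integer $m$, $J_{2m}=\begin{bmatrix}0&I_m\\-I_m&0\end{bmatrix}$. The symplectic Stiefel manifold is $\mathrm{Sp}(2p,2n)=\{X\in\mathbb{R}^{2n\times 2p}: X^\top J_{2n}X=J_{2p}\}$, an embedded submanifold of $\mathbb{R}^{2n\times 2p}$, with tangent space $\mathrm{T}_X\mathrm{Sp}(2p,2n)=\{Z\in\mathbb{R}^{2n\times 2p}: Z^\top J_{2n}X+X^\top J_{2n}Z=0\}$ and tangent bundle $\mathrm{T}\,\mathrm{Sp}(2p,2n)$. A retraction on a manifold $\mathcal{M}$ (not necessarily globally defined) is a smooth map $\mathcal{R}$ from a subset of $\mathrm{T}\mathcal{M}$ to $\mathcal{M}$ such that for all $X\in\mathcal{M}$, with $\mathcal{R}_X$ the restriction of $\mathcal{R}$ to $\mathrm{T}_X\mathcal{M}$: $\mathcal{R}_X$ is defined in a neighborhood of the origin $0_X$ of $\mathrm{T}_X\mathcal{M}$; $\mathcal{R}_X(0_X)=X$; and $\frac{\mathrm{d}}{\mathrm{d}t}\mathcal{R}_X(tZ)|_{t=0}=Z$ for all $Z\in\mathrm{T}_X\mathcal{M}$. *)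

(* Defs.v *)
From HB Require Import structures.
From mathcomp Require Import all_boot all_order all_algebra.
From mathcomp Require Import all_classical all_reals all_analysis.

Set Implicit Arguments.
Unset Strict Implicit.
Unset Printing Implicit Defensive.

Import Order.TTheory GRing.Theory Num.Theory.
Import numFieldNormedType.Exports.

Local Open Scope classical_set_scope.
Local Open Scope ring_scope.

(* Class C^k on a set U, only meant for U open and V, W finite-dimensional:
   continuity of the k-th Frechet derivative is then the same as continuity of
   x |-> D^k f(x)[v_1, ..., v_k] for each choice of the directions v_i. *)
Fixpoint Ck_on (R : realType) (V W : normedModType R) (k : nat)
    (U : set V) (f : V -> W) : Prop :=
  match k with
  | 0 => forall x, U x -> {for x, continuous f}
  | k'.+1 => (forall x, U x -> differentiable f x) /\
             (forall v : V, Ck_on k' U (fun x => 'd f x v))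
  end.

(* Smoothness on an arbitrary subset A of V: local extendability to C^oo maps
   on open sets of V. When A is open in an embedded submanifold of V (such as a
   tangent bundle) this is smoothness in the sense of charts, and for a map with
   values in an embedded submanifold of W it does not matter whether the
   codomain is the submanifold or W. *)
Definition smooth_on (R : realType) (V W : normedModType R)
    (A : set V) (f : V -> W) : Prop :=
  forall x, A x -> exists (U : set V) (g : V -> W),
    [/\ open U, U x, forall k, Ck_on k U g & {in A `&` U, f =1 g}].

Definition tangent_bundle (V : Type) (M : set V) (T : V -> set V) :
    set (V * V) :=
  [set xz | M xz.1 /\ T xz.1 xz.2].

(* Retractions on a submanifold M of V with tangent spaces T x; rho x z is only
   meaningful for (x, z) in the domain D. *)
Record is_retraction (R : realType) (V : normedModType R)
    (M : set V) (T : V -> set V) (D : set (V * V)) (rho : V -> V -> V) :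
    Prop := IsRetraction {
  retr_dom : D `<=` tangent_bundle M T;
  retr_codom : forall x z, D (x, z) -> M (rho x z);
  retr_smooth : smooth_on D (fun xz : V * V => rho xz.1 xz.2);
  retr_nbhs : forall x, M x -> \forall z \near within (T x) (nbhs 0), D (x, z);
  retr0 : forall x, M x -> rho x 0 = x;
  retr_derive : forall x z, M x -> T x z ->
    is_derive (0 : R) (1 : R) (fun t : R => rho x (t *: z)) z }.

Section Symplectic.
Variable R : realType.

Definition Jmx (m : nat) : 'M[R]_(m + m) :=
  block_mx 0 1%:M (- 1%:M) 0.

Variables n p : nat.
Implicit Types X Z : 'M[R]_(n + n, p + p).

Definition Sp : set 'M[R]_(n + n, p + p) :=
  [set X | X^T *m Jmx n *m X = Jmx p].

Definition TSp X : set 'M[R]_(n + n, p + p) :=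
  [set Z | Z^T *m Jmx n *m X + X^T *m Jmx n *m Z = 0].

Definition Gmx X : 'M[R]_(n + n) :=
  1%:M - 2^-1 *: (X *m Jmx p *m X^T *m (Jmx n)^T).

Definition Smx X Z : 'M[R]_(n + n) :=
  Gmx X *m Z *m (X *m Jmx p)^T + X *m Jmx p *m (Gmx X *m Z)^T.

Definition cayley_dom :
    set ('M[R]_(n + n, p + p) * 'M[R]_(n + n, p + p)) :=
  [set XZ | [/\ Sp XZ.1, TSp XZ.1 XZ.2 &
                1%:M - 2^-1 *: (Smx XZ.1 XZ.2 *m Jmx n) \in unitmx]].

Definition cayley X Z : 'M[R]_(n + n, p + p) :=
  invmx (1%:M - 2^-1 *: (Smx X Z *m Jmx n)) *m
  (1%:M + 2^-1 *: (Smx X Z *m Jmx n)) *m X.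

End Symplectic.

(* Main.v *)
Require Import Defs.
From HB Require Import structures.
From mathcomp Require Import all_boot all_order all_algebra.
From mathcomp Require Import all_classical all_reals all_analysis.

(** Write J for the symplectic matrix, S for the symmetric matrix attached to
(X, Z), and B = S J / 2.  The map is the Cayley transform
C = (1 - B)^-1 (1 + B) applied to X, and every clause of the definition of a
retraction comes from one of three facts.

Codomain.  S is symmetric and J antisymmetric, so B is Hamiltonian:
B^T J = - J B.  Hence (1 - B)^T J (1 - B) = J (1 + B) (1 - B)
= (1 + B)^T J (1 + B), which says that C preserves the form J
([cayley_isometry]); so C X is symplectic when X is ([cayley_Sp]).

First-order behaviour.  The factor G_X is chosen so that S J X = Z for every
tangent vector Z ([SmxJX]).  Consequently
(1 - B) (C X - X) = (1 + B) X - (1 - B) X = S J X = Z ([cayley_sub]).  Along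
t |-> t Z the difference quotient at 0 is therefore exactly
(1 - t B)^-1 Z, which tends to Z by continuity of the matrix inverse.

Smoothness.  The formula makes sense on all pairs of matrices with 1 - B
invertible, an open set, and its entries are rational functions of those of X
and Z.  The class C^k on an open set is stable under sums, products of scalar
functions, inverses of nowhere vanishing ones and continuous linear maps, and
a matrix-valued map is C^k as soon as its entries are; through the cofactor
formula this covers the matrix inverse ([Ck_on_invmx]).  Openness of the
domain also gives the neighbourhood of the origin, since B = 0 at Z = 0. *)

Set Implicit Arguments.
Unset Strict Implicit.
Unset Printing Implicit Defensive.

Import Order.TTheory GRing.Theory Num.Theory.
Import numFieldNormedType.Exports.

Local Open Scope classical_set_scope.
Local Open Scope ring_scope.

(** * Functions of class C^k on an open set *)

Section CkCalculus.
Variable R : realType.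
Implicit Types V W : normedModType R.

(** The difference of f and g vanishes near x, so its Taylor remainder with
zero differential is eventually zero. *)
Lemma near_eq_differentiable V W (f g : V -> W) (x : V) :
  (\near x, f x = g x) -> differentiable f x -> differentiable g x.
Proof.
move=> fg df; have -> : g = f + (g - f) by rewrite addrC subrK.
apply: differentiableD => //; set h := g - f.
have h0 : \forall y \near x, h y = 0.
  near=> y; rewrite /h !fctE; apply/eqP; rewrite subr_eq0 eq_sym.
  by apply/eqP; near: y.
have hx : h x = 0 by exact: nbhs_singleton h0.
have dh : h \o shift x = cst (h x) + (\0 : V -> W) +o_ 0 id.
  apply/eqaddoP => _/posnumP[e]; rewrite hx.
  have h0' : \forall y \near 0, h (y + x) = 0.
    have := h0; rewrite (near_shift 0) /=.
    by apply: filterS => y; rewrite /= subr0.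
  near=> y.
  rewrite !fctE /= [h (y + x)](near h0' y) ?subr0 ?normr0 ?mulr_ge0 //.
  by rewrite addr0 oppr0 addr0 normr0 mulr_ge0.
have c0 : continuous (\0 : V -> W) by move=> y; exact: cst_continuous.
apply/diff_locallyP; rewrite (diff_unique c0 dh); split => //.
Unshelve. all: by end_near. Qed.

(** The differential of a sum, product or inverse obeys the usual formula only
at points of differentiability, that is on U; this congruence lets the
inductions on k below replace such a differential by its formula. *)
Lemma Ck_on_eq V W (k : nat) (U : set V) (f g : V -> W) :
  open U -> (forall x, U x -> f x = g x) -> Ck_on k U f -> Ck_on k U g.
Proof.
move=> oU; elim: k f g => [|k IH] f g fg.
  move=> cf x Ux; have nU : nbhs x U by exact: open_nbhs_nbhs.
  rewrite /prop_for /continuous_at -(fg _ Ux); apply: cvg_trans (cf _ Ux).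
  by apply: near_eq_cvg; apply: filterS nU => y; exact: fg.
have nfg x : U x -> \near x, f x = g x.
  by move=> Ux; apply: filterS (open_nbhs_nbhs (conj oU Ux)) => y; exact: fg.
move=> [df ddf]; have dg x : U x -> differentiable g x.
  by move=> Ux; apply: near_eq_differentiable (df x Ux); exact: nfg.
split=> // v; apply: IH (ddf v) => x Ux.
by rewrite -!deriveE; [exact/near_eq_derive/nfg | exact: dg | exact: df].
Qed.

Lemma Ck_onW V W (k : nat) (U : set V) (f : V -> W) :
  Ck_on k.+1 U f -> Ck_on k U f.
Proof.
elim: k f => [|k IH] f [df ddf].
  by move=> x Ux; exact/differentiable_continuous/df.
by split=> // v; exact: IH.
Qed.

Lemma Ck_on_cst V W (k : nat) (U : set V) (w : W) : Ck_on k U (fun=> w).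
Proof.
elim: k w => [|k IH] w; first by move=> x _; exact: cst_continuous.
split=> [x _|v]; first exact: differentiable_cst.
rewrite (_ : (fun _ => _) = fun=> 0); first exact: IH.
by apply/funext => x; rewrite (diff_cst w).
Qed.

Lemma Ck_onD V W (k : nat) (U : set V) (f g : V -> W) : open U ->
  Ck_on k U f -> Ck_on k U g -> Ck_on k U (fun x => f x + g x).
Proof.
move=> oU; elim: k f g => [|k IH] f g.
  by move=> cf cg x Ux; apply: cvgD; [exact: cf | exact: cg].
move=> [df ddf] [dg ddg]; split=> [x Ux|v].
  by apply: differentiableD; [exact: df | exact: dg].
apply: (Ck_on_eq oU _ (IH _ _ (ddf v) (ddg v))) => x Ux.
apply/esym; exact: (congr1 (@^~ v) (diffD (df _ Ux) (dg _ Ux))).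
Qed.

Lemma Ck_onM V (k : nat) (U : set V) (f g : V -> R) : open U ->
  Ck_on k U f -> Ck_on k U g -> Ck_on k U (fun x => f x * g x).
Proof.
move=> oU; elim: k f g => [|k IH] f g.
  by move=> cf cg x Ux; apply: cvgM; [exact: cf | exact: cg].
move=> Cf Cg; have [[df ddf] [dg ddg]] := (Cf, Cg); split=> [x Ux|v].
  by apply: differentiableM; [exact: df | exact: dg].
have Cd := Ck_onD oU (IH _ _ (Ck_onW Cf) (ddg v)) (IH _ _ (Ck_onW Cg) (ddf v)).
apply: (Ck_on_eq oU _ Cd) => x Ux.
apply/esym; exact: (congr1 (@^~ v) (diffM (df _ Ux) (dg _ Ux))).
Qed.

(** The induction works because the differential of 1/f is - (1/f)^2 df, where
1/f is already known to be of class C^k. *)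
Lemma Ck_onV V (k : nat) (U : set V) (f : V -> R) : open U ->
  (forall x, U x -> f x != 0) -> Ck_on k U f -> Ck_on k U (fun x => (f x)^-1).
Proof.
move=> oU f0; elim: k => [|k IH].
  by move=> cf x Ux; apply: cvgV; [exact: f0 | exact: cf].
move=> Cf; have [df ddf] := Cf; have CV := IH (Ck_onW Cf).
split=> [x Ux|v]; first by apply: differentiableV; [exact: df | exact: f0].
have CN := Ck_onM oU (Ck_on_cst k U (-1 : R)) (Ck_onM oU CV CV).
have Cd := Ck_onM oU CN (ddf v).
apply: (Ck_on_eq oU _ Cd) => x Ux.
apply: etrans _ (esym (congr1 (@^~ v) (diffV (df _ Ux) (f0 _ Ux)))).
by rewrite mulN1r -invfM.
Qed.

Lemma Ck_onZl V W (k : nat) (U : set V) (f : V -> R) (w : W) : open U ->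
  Ck_on k U f -> Ck_on k U (fun x => f x *: w).
Proof.
move=> oU; elim: k f => [|k IH] f.
  by move=> cf x Ux; apply: cvgZr_tmp; exact: cf.
move=> [df ddf]; split=> [x Ux|v]; first exact/differentiableZl/df.
apply: (Ck_on_eq oU _ (IH _ (ddf v))) => x Ux.
by rewrite (diffZl _ (df _ Ux)).
Qed.

Lemma Ck_on_linear V W (k : nat) (U : set V) (L : {linear V -> W}) :
  continuous L -> Ck_on k U L.
Proof.
move=> cL; case: k => [|k]; first by move=> x _; exact: cL.
split=> [x _|v]; first exact: linear_differentiable.
rewrite (_ : (fun _ => _) = fun=> L v); first exact: Ck_on_cst.
by apply/funext => x; rewrite diff_lin.
Qed.

Lemma Ck_on_comp_linear V W W' (k : nat) (U : set V) (f : V -> W)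
    (L : {linear W -> W'}) : open U ->
  continuous L -> Ck_on k U f -> Ck_on k U (L \o f).
Proof.
move=> oU cL; elim: k f => [|k IH] f.
  by move=> cf x Ux; apply: continuous_comp; [exact: cf | exact: cL].
move=> [df ddf]; split=> [x Ux|v].
  by apply: differentiable_comp; [exact: df | exact: linear_differentiable].
apply: (Ck_on_eq oU _ (IH _ (ddf v))) => x Ux.
by rewrite diff_comp ?diff_lin//; [exact: df | exact: linear_differentiable].
Qed.

Lemma Ck_on_sum V W (k : nat) (U : set V) (I : Type) (r : seq I) (P : pred I)
    (F : I -> V -> W) : open U -> (forall i, Ck_on k U (F i)) ->
  Ck_on k U (fun x => \sum_(i <- r | P i) F i x).
Proof.
move=> oU CF; elim: r => [|i r IH].
  by under eq_fun do rewrite big_nil; exact: Ck_on_cst.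
under eq_fun do rewrite big_cons.
by case: (P i) => //; exact: Ck_onD.
Qed.

Lemma Ck_on_prod V (k : nat) (U : set V) (I : Type) (r : seq I) (P : pred I)
    (F : I -> V -> R) : open U -> (forall i, Ck_on k U (F i)) ->
  Ck_on k U (fun x => \prod_(i <- r | P i) F i x).
Proof.
move=> oU CF; elim: r => [|i r IH].
  by under eq_fun do rewrite big_nil; exact: Ck_on_cst.
under eq_fun do rewrite big_cons.
by case: (P i) => //; exact: Ck_onM.
Qed.

End CkCalculus.

(** * Matrix-valued functions of class C^k *)

Section CkMatrix.
Variables (R : realType) (V : normedModType R) (k : nat) (U : set V).
Hypothesis oU : open U.

(** Entries are continuous linear forms, and conversely F is the sum of its
entries times the elementary matrices.  This reduces matrix operations to
scalar ones. *)
Lemma Ck_on_mxP m n (F : V -> 'M[R]_(m, n)) :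
  Ck_on k U F <-> forall i j, Ck_on k U (fun x => F x i j).
Proof.
split=> [CF i j|CF].
  have lin : linear (fun N : 'M[R]_(m, n) => N i j : R).
    by move=> a M N; rewrite !mxE.
  pose lM := GRing.isLinear.Build _ _ _ _ _ lin.
  pose L : {linear 'M[R]_(m, n) -> R} :=
    HB.pack (fun N : 'M[R]_(m, n) => N i j : R) lM.
  by apply: (@Ck_on_comp_linear _ _ _ _ k U F L) => //; exact: coord_continuous.
rewrite (_ : F = fun x => \sum_i \sum_j F x i j *: delta_mx i j); last first.
  by apply/funext => x; exact: matrix_sum_delta.
by apply: Ck_on_sum => // i; apply: Ck_on_sum => // j; exact: Ck_onZl.
Qed.

Lemma Ck_on_mulmx m n q (F : V -> 'M[R]_(m, n)) (G : V -> 'M[R]_(n, q)) :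
  Ck_on k U F -> Ck_on k U G -> Ck_on k U (fun x => F x *m G x).
Proof.
move=> /Ck_on_mxP CF /Ck_on_mxP CG; apply/Ck_on_mxP => i j.
under eq_fun do rewrite mxE.
by apply: Ck_on_sum => // l; exact: Ck_onM.
Qed.

Lemma Ck_on_trmx m n (F : V -> 'M[R]_(m, n)) :
  Ck_on k U F -> Ck_on k U (fun x => (F x)^T).
Proof.
by move=> /Ck_on_mxP CF; apply/Ck_on_mxP => i j; under eq_fun do rewrite mxE.
Qed.

Lemma Ck_onZ m n (a : R) (F : V -> 'M[R]_(m, n)) :
  Ck_on k U F -> Ck_on k U (fun x => a *: F x).
Proof.
move=> /Ck_on_mxP CF; apply/Ck_on_mxP => i j; under eq_fun do rewrite mxE.
by apply: Ck_onM => //; exact: Ck_on_cst.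
Qed.

Lemma Ck_onB m n (F G : V -> 'M[R]_(m, n)) :
  Ck_on k U F -> Ck_on k U G -> Ck_on k U (fun x => F x - G x).
Proof.
move=> CF CG; under eq_fun do rewrite -scaleN1r.
by apply: Ck_onD => //; exact: Ck_onZ.
Qed.

Lemma Ck_on_det n (F : V -> 'M[R]_n) :
  Ck_on k U F -> Ck_on k U (fun x => \det (F x)).
Proof.
move=> /Ck_on_mxP CF; apply: Ck_on_sum => // s.
by apply: Ck_onM => //; [exact: Ck_on_cst | exact: Ck_on_prod].
Qed.

Lemma Ck_on_invmx n (F : V -> 'M[R]_n) : (forall x, U x -> F x \in unitmx) ->
  Ck_on k U F -> Ck_on k U (fun x => invmx (F x)).
Proof.
move=> uF CF; have F0 x : U x -> \det (F x) != 0.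
  by move=> /uF; rewrite unitmxE unitfE.
pose G x := \matrix_(i, j) ((\det (F x))^-1 * cofactor (F x) j i).
apply: (@Ck_on_eq _ _ _ k U G) => // [x Ux|].
  by rewrite /invmx uF//; apply/matrixP => i j; rewrite !mxE.
apply/Ck_on_mxP => i j; under eq_fun do rewrite mxE.
apply: Ck_onM => //; first by apply: Ck_onV => //; exact: Ck_on_det.
apply: Ck_onM => //; first exact: Ck_on_cst.
apply: Ck_on_det; apply/Ck_on_mxP => a b.
under eq_fun do rewrite !mxE; exact: (Ck_on_mxP F).1.
Qed.

End CkMatrix.

(** * Cayley transforms preserve a bilinear form *)

Section CayleyAlgebra.
Variable R : realType.

Lemma trmx_Jmx m : (Jmx R m)^T = - Jmx R m.
Proof.
by rewrite /Jmx tr_block_mx !linearN /= !trmx0 trmx1 opp_block_mx !oppr0 opprK.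
Qed.

Lemma mulmx_trJ_J m : (Jmx R m)^T *m Jmx R m = 1%:M.
Proof.
rewrite trmx_Jmx mulNmx /Jmx mulmx_block !mulmx0 !mul0mx !mulmx1 !mul1mx.
by rewrite !addr0 !add0r opp_block_mx opprK oppr0 -scalar_mx_block.
Qed.

Variable m : nat.
Implicit Types B C : 'M[R]_m.

Lemma mulmx_subC_add B : (1%:M - B) *m (1%:M + B) = (1%:M + B) *m (1%:M - B).
Proof.
by rewrite mulmxBl mulmxBr mulmx1 mul1mx mulmxDl mulmxDr mulmx1 mul1mx.
Qed.

Lemma cayley_mulmxC B : 1%:M - B \in unitmx ->
  invmx (1%:M - B) *m (1%:M + B) *m (1%:M - B) = 1%:M + B.
Proof. by move=> u; rewrite -mulmxA -mulmx_subC_add mulKmx. Qed.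

(** B lies in the Lie algebra of the isometry group of J.  Conjugating by the
invertible 1 - B turns the claim into
(1 + B)^T J (1 + B) = (1 - B)^T J (1 - B); moving the transposes across J
makes the two sides J (1 - B) (1 + B) and J (1 + B) (1 - B). *)
Lemma cayley_isometry (J B : 'M[R]_m) : B^T *m J = - (J *m B) ->
  1%:M - B \in unitmx ->
  let C := invmx (1%:M - B) *m (1%:M + B) in C^T *m J *m C = J.
Proof.
move=> BJ u C.
have CB : C *m (1%:M - B) = 1%:M + B by exact: cayley_mulmxC.
clearbody C; have uT : (1%:M - B)^T \in unitmx by rewrite unitmx_tr.
apply: (can_inj (mulKmx uT)); apply: (can_inj (mulmxK u)).
transitivity ((C *m (1%:M - B))^T *m J *m (C *m (1%:M - B))).
  by rewrite trmx_mul !mulmxA.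
have -> : (1%:M - B)^T *m J = J *m (1%:M + B).
  by rewrite linearB /= trmx1 mulmxBl mul1mx BJ opprK mulmxDr mulmx1.
have -> : (C *m (1%:M - B))^T *m J = J *m (1%:M - B).
  by rewrite CB linearD /= trmx1 mulmxDl mul1mx BJ mulmxBr mulmx1.
by rewrite CB -!mulmxA mulmx_subC_add.
Qed.

End CayleyAlgebra.

(** * The algebra of the symplectic Stiefel manifold *)

Section SymplecticAlgebra.
Variables (R : realType) (n p : nat).
Implicit Types X Z : 'M[R]_(n + n, p + p).
Local Notation Jn := (Jmx R n).
Local Notation Jp := (Jmx R p).

Lemma TSpZ X Z (t : R) : TSp X Z -> TSp X (t *: Z).
Proof.
rewrite /TSp /= => tZ; rewrite linearZ /= -!scalemxAl -scalemxAr -scalerDr.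
by rewrite tZ scaler0.
Qed.

Lemma Smx_sym X Z : (Smx X Z)^T = Smx X Z.
Proof. by rewrite /Smx linearD /= !trmx_mul !trmxK addrC !mulmxA. Qed.

Lemma Smx_Hamiltonian X Z :
  (2^-1 *: (Smx X Z *m Jn))^T *m Jn = - (Jn *m (2^-1 *: (Smx X Z *m Jn))).
Proof.
rewrite linearZ /= trmx_mul Smx_sym trmx_Jmx -scalemxAl -scalemxAr.
by rewrite !mulNmx scalerN !mulmxA.
Qed.

Lemma SmxZ X Z (t : R) : Smx X (t *: Z) = t *: Smx X Z.
Proof.
rewrite /Smx -!scalemxAr [in X in _ + X]linearZ /= -scalemxAl -scalemxAr.
by rewrite scalerDr.
Qed.

(** Since (X J)^T J X = 1, the first half of S contributes G Z, that is
Z + X J X^T J Z / 2; since G^T J X = J X / 2, the second half contributes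
X J Z^T J X / 2.  The two corrections add up to X J / 2 times the left-hand
side of the tangency equation, hence cancel. *)
Lemma SmxJX X Z : Sp X -> TSp X Z -> Smx X Z *m Jn *m X = Z.
Proof.
rewrite /Sp /TSp /= => spX tZ.
have XJX : (X *m Jp)^T *m (Jn *m X) = 1%:M.
  by rewrite trmx_mul -mulmxA [X^T *m _]mulmxA spX mulmx_trJ_J.
have GJX : (Gmx X)^T *m (Jn *m X) = 2^-1 *: (Jn *m X).
  have -> : (Gmx X)^T = 1%:M - 2^-1 *: (Jn *m X *m Jp^T *m X^T).
    by rewrite /Gmx linearB linearZ /= trmx1 !trmx_mul !trmxK !mulmxA.
  rewrite mulmxBl mul1mx -scalemxAl -(mulmxA (Jn *m X *m Jp^T)).
  rewrite [X^T *m _]mulmxA spX -(mulmxA (Jn *m X)) mulmx_trJ_J mulmx1.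
  rewrite -[X in X - _]scale1r -scalerBl.
  by congr (_ *: _); rewrite [X in X - _](splitr 1) mul1r addrK.
have GZE : Gmx X *m Z = Z + 2^-1 *: (X *m Jp *m (X^T *m Jn *m Z)).
  rewrite /Gmx trmx_Jmx mulmxN scalerN opprK mulmxDl mul1mx -scalemxAl.
  by rewrite !mulmxA.
rewrite /Smx 2!mulmxDl.
have -> : Gmx X *m Z *m (X *m Jp)^T *m Jn *m X = Gmx X *m Z.
  by rewrite -(mulmxA _ Jn X) -mulmxA XJX mulmx1.
have -> : X *m Jp *m (Gmx X *m Z)^T *m Jn *m X =
    2^-1 *: (X *m Jp *m (Z^T *m Jn *m X)).
  by rewrite -(mulmxA _ Jn X) trmx_mul -!mulmxA GJX -!scalemxAr.
rewrite GZE -addrA -scalerDr -mulmxDr [X in _ *m X]addrC tZ.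
by rewrite mulmx0 scaler0 addr0.
Qed.

Lemma cayley_Sp X Z : Sp X ->
  1%:M - 2^-1 *: (Smx X Z *m Jn) \in unitmx -> Sp (cayley X Z).
Proof.
rewrite /Sp /= => spX u.
have CJC := cayley_isometry (Smx_Hamiltonian X Z) u.
rewrite /cayley trmx_mul -[RHS]spX -[in RHS]CJC.
by rewrite !mulmxA.
Qed.

(** Being exact, not merely first-order, this reduces the derivative at the
origin to the continuity of a matrix inverse. *)
Lemma cayley_sub X Z : Sp X -> TSp X Z ->
  1%:M - 2^-1 *: (Smx X Z *m Jn) \in unitmx ->
  cayley X Z - X = invmx (1%:M - 2^-1 *: (Smx X Z *m Jn)) *m Z.
Proof.
move=> spX tZ u; rewrite /cayley; set B := 2^-1 *: _.
rewrite -[X in _ - X](mulKmx u) -mulmxA -mulmxBr; congr (_ *m _).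
rewrite mulmxDl mulmxBl mul1mx opprB [RHS](_ : _ = B *m X + B *m X).
  by rewrite -addrA addrC !addrA subrK.
rewrite -scalemxAl SmxJX // -scalerDl.
by rewrite [_ + _](_ : _ = 1) ?scale1r // [RHS](splitr 1) mul1r.
Qed.

End SymplecticAlgebra.

(** * Regularity of the Cayley map *)

Section CayleyAnalysis.
Variables (R : realType) (n p : nat).
Local Notation M := 'M[R]_(n + n, p + p).
Local Notation den X Z := (1%:M - 2^-1 *: (Smx X Z *m Jmx R n)).

Lemma Ck_on_Smx (V : normedModType R) k (U : set V) (X Z : V -> M) : open U ->
  Ck_on k U X -> Ck_on k U Z -> Ck_on k U (fun x => Smx (X x) (Z x)).
Proof.
move=> oU CX CZ.
have CXJ : Ck_on k U (fun x => X x *m Jmx R p).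
  by apply: Ck_on_mulmx => //; exact: Ck_on_cst.
have CGZ : Ck_on k U (fun x => Gmx (X x) *m Z x).
  apply: Ck_on_mulmx => //; apply: Ck_onB => //; first exact: Ck_on_cst.
  apply: Ck_onZ => //; apply: Ck_on_mulmx => //; last exact: Ck_on_cst.
  by apply: Ck_on_mulmx => //; exact: Ck_on_trmx.
by apply: Ck_onD => //; apply: Ck_on_mulmx => //; exact: Ck_on_trmx.
Qed.

Lemma Ck_on_den (V : normedModType R) k (U : set V) (X Z : V -> M) : open U ->
  Ck_on k U X -> Ck_on k U Z -> Ck_on k U (fun x => den (X x) (Z x)).
Proof.
move=> oU CX CZ; apply: Ck_onB => //; first exact: Ck_on_cst.
apply: Ck_onZ => //; apply: Ck_on_mulmx => //; last exact: Ck_on_cst.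
exact: Ck_on_Smx.
Qed.

Lemma Ck_on_cayley (V : normedModType R) k (U : set V) (X Z : V -> M) :
  open U ->
  (forall x, U x -> den (X x) (Z x) \in unitmx) ->
  Ck_on k U X -> Ck_on k U Z -> Ck_on k U (fun x => cayley (X x) (Z x)).
Proof.
move=> oU uU CX CZ.
have CSJ : Ck_on k U (fun x => 2^-1 *: (Smx (X x) (Z x) *m Jmx R n)).
  apply: Ck_onZ => //; apply: Ck_on_mulmx => //; last exact: Ck_on_cst.
  exact: Ck_on_Smx.
apply: Ck_on_mulmx => //; apply: Ck_on_mulmx => //.
  apply: Ck_on_invmx => //; apply: Ck_onB => //; exact: Ck_on_cst.
by apply: Ck_onD => //; exact: Ck_on_cst.
Qed.

(** Invertibility is the non-vanishing of a continuous determinant.  Arbitrary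
maps X and Z are allowed because the set is needed in the space of pairs, in
the space of Z for fixed X, and on the line spanned by Z. *)
Lemma open_cayley_unit (V : normedModType R) (X Z : V -> M) :
  Ck_on 0 setT X -> Ck_on 0 setT Z ->
  open [set x | den (X x) (Z x) \in unitmx].
Proof.
move=> CX CZ; have oT : open (setT : set V) by exact: openT.
have cdet : continuous (fun x => \det (den (X x) (Z x))).
  have C := Ck_on_det oT (Ck_on_den oT CX CZ).
  by move=> x; exact: C.
rewrite [X in open X](_ : _ =
    (fun x => \det (den (X x) (Z x))) @^-1` [set y | y != 0]).
  by apply: open_comp; [move=> x _; exact: cdet | exact: open_neq].
by apply/seteqP; split => x /=; rewrite unitmxE unitfE.
Qed.

Lemma Smx0 (X : M) : Smx X 0 = 0.
Proof. by rewrite -(scale0r (0 : M)) SmxZ scale0r. Qed.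

Lemma cayley0 (X : M) : cayley X 0 = X.
Proof.
by rewrite /cayley Smx0 mul0mx scaler0 subr0 addr0 invmx1 !mul1mx.
Qed.

(** By [cayley_sub] the difference quotient is (1 - t S J / 2)^-1 Z for
small nonzero t. *)
Lemma cayley_is_derive (X Z : M) : Sp X -> TSp X Z ->
  is_derive (0 : R) 1 (fun t : R => cayley X (t *: Z)) Z.
Proof.
move=> spX tZ.
have oT : open (setT : set R) by exact: openT.
have CT k (U : set R) : open U -> Ck_on k U (fun t : R => t *: Z).
  move=> oU; apply: Ck_onZl => //.
  by apply: (@Ck_on_linear _ _ _ k U idfun) => ?.
set D := fun t : R => den X (t *: Z).
pose U := [set t | D t \in unitmx].
have oU : open U.
  exact: (@open_cayley_unit _ (fun=> X) _ (Ck_on_cst _ _ _) (CT _ _ oT)).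
have D0 : D 0 = 1%:M by rewrite /D scale0r Smx0 mul0mx scaler0 subr0.
have U0 : U 0 by rewrite /U /= D0 unitmx1.
have cinv : invmx (D t) *m Z @[t --> 0] --> Z.
  have CD := Ck_on_den oU (Ck_on_cst 0 U X) (CT 0 U oU).
  have CI := Ck_on_invmx oU (fun t Ut => Ut) CD.
  have C := Ck_on_mulmx oU CI (Ck_on_cst 0 U Z).
  have := C 0 U0; rewrite /prop_for /continuous_at D0 invmx1 mul1mx.
  exact.
have cq : h^-1 *: (((fun t : R => cayley X (t *: Z)) \o shift 0) (h *: 1)
    - cayley X (0 *: Z)) @[h --> (0 : R)^'] --> Z.
  apply: cvg_trans (cvg_trans (cvg_app _ (@nbhs_dnbhs _ _)) cinv).
  apply: near_eq_cvg; near=> h.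
  have h0 : h != 0 by near: h; exact: nbhs_dnbhs_neq.
  have Uh : U h by near: h; apply: nbhs_dnbhs; exact: open_nbhs_nbhs.
  rewrite /= addr0 scale0r cayley0 [h *: 1]mulr1 cayley_sub //; last first.
    exact: TSpZ.
  by rewrite -scalemxAr scalerA mulVf // scale1r.
by split; [apply/cvg_ex; exists Z | exact: cvg_lim].
Unshelve. all: by end_near. Qed.

End CayleyAnalysis.

Theorem proposition5p3 (R : realType) (n p : nat)
    (p_gt0 : (0 < p)%N) (le_pn : (p <= n)%N) :
  is_retraction (@Sp R n p) (@TSp R n p) (@cayley_dom R n p) (@cayley R n p).
Proof.
set M := 'M[R]_(n + n, p + p).
split=> [[X Z] [spX tZ _] //|X Z [spX _ u]|[X Z] [spX tZ u]|X spX|X _|X Z].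
- exact: cayley_Sp.
- have C1 k U : Ck_on k U (fst : M * M -> M).
    by exact: (@Ck_on_linear _ _ _ k U (@fst M M)) (fun=> cvg_fst).
  have C2 k U : Ck_on k U (snd : M * M -> M).
    by exact: (@Ck_on_linear _ _ _ k U (@snd M M)) (fun=> cvg_snd).
  exists [set XZ : M * M |
    1%:M - 2^-1 *: (Smx XZ.1 XZ.2 *m Jmx R n) \in unitmx].
  exists (fun XZ : M * M => cayley XZ.1 XZ.2); split => // [|k].
    exact: open_cayley_unit.
  by apply: Ck_on_cayley => //; exact: open_cayley_unit.
- have oU : open [set Z : M | 1%:M - 2^-1 *: (Smx X Z *m Jmx R n) \in unitmx].
    apply: (@open_cayley_unit _ _ _ _ (fun=> X) id).
      exact: Ck_on_cst.
    by apply: (@Ck_on_linear _ _ _ 0 setT idfun) => ?.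
  have U0 : 1%:M - 2^-1 *: (Smx X 0 *m Jmx R n) \in unitmx.
    by rewrite Smx0 mul0mx scaler0 subr0 unitmx1.
  have := open_nbhs_nbhs (conj oU U0).
  by apply: filterS => Z u tZ.
- exact: cayley0.
- exact: cayley_is_derive.
Qed.
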